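(* Let $X\subset\mathbb R^2$ be a Suslinian plane continuum. If $Y\subset X$ is a totally disconnected Borel set, then $Y$ is zero-dimensional at all but countably many of its points; that is, the set $\Lambda(Y)$ is countable.
   Context: A continuum is a compact connected metric space. A space is Suslinian if every collection of pairwise disjoint non-degenerate subcontinua of it is countable. A space $Y$ is totally disconnected if every two distinct points of $Y$ lie in disjoint clopen subsets of $Y$ (equivalently, for any two distinct points there is a clopen set containing one but not the other). $Y$ is zero-dimensional at $y\in Y$ if $y$ has a neighborhood basis in $Y$ consisting of clopen subsets of $Y$. $\Lambda(Y)$ denotes the set of points of $Y$ at which $Y$ is not zero-dimensional. *)

(* Defs.v *)
(* The plane R^2 is modelled as R * R (product
   topology / metric) for an arbitrary R : realType. *)
From HB Require Import structures.
From mathcomp Require Import all_boot all_order all_algebra.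
From mathcomp Require Import all_classical all_reals all_analysis.
Set Implicit Arguments. Unset Strict Implicit. Unset Printing Implicit Defensive.
Import Order.TTheory GRing.Theory Num.Theory.
Local Open Scope classical_set_scope.

Section Defs.
Variable T : topologicalType.

Definition borel_set (A : set T) : Prop := <<s open >> A.

(* continuum: nonempty compact connected (metric space: T will be R*R) *)
Definition continuum (X : set T) : Prop :=
  X !=set0 /\ compact X /\ connected X.

Definition nondegenerate (K : set T) : Prop :=
  exists x y, K x /\ K y /\ x <> y.

Definition suslinian (X : set T) : Prop :=
  forall F : set (set T),
    (forall K, F K -> K `<=` X /\ continuum K /\ nondegenerate K) ->
    (forall K L, F K -> F L -> K <> L -> K `&` L = set0) ->
    countable F.

Definition clopen_in (Y C : set T) : Prop :=
  C `<=` Y /\ (exists U, open U /\ C = U `&` Y) /\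
  (exists F, closed F /\ C = F `&` Y).

Definition tot_disconnected (Y : set T) : Prop :=
  forall x y, Y x -> Y y -> x <> y ->
    exists C, clopen_in Y C /\ C x /\ ~ C y.

Definition zero_dim_at (Y : set T) (y : T) : Prop :=
  forall V, nbhs y V -> exists C, clopen_in Y C /\ C y /\ C `<=` V `&` Y.

Definition Lambda (Y : set T) : set T :=
  [set y | Y y /\ ~ zero_dim_at Y y].

End Defs.

(* Main.v *)
(* For y in Y let L(y) be the intersection of the closures of the clopen subsets
   of Y that contain y.  Total disconnectedness gives L(y) /\ Y = {y}, and
   L(y) <> {y} when y is in Lambda(Y).  So, up to one of four isometries, it is
   enough to treat, for rationals a < b, the points y on the left of the line
   x = a such that L(y) has a point on the right of the line x = b.  Let K(y) be
   the component of y in the part of L(y) in the half-plane x <= b.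

   If z_1, ..., z_n are finitely many other points of Y, then y is joined to the
   line x = b by a path near K(y) that avoids L(z_1), ..., L(z_n): otherwise a
   component of the complement of these sets would cut out of Y a clopen
   neighbourhood of y inside x <= b, and L(y) would lie in x <= b.  A cluster
   point k(y) of the ends of these paths lies in K(y).

   Connected sets and paths in the half-plane x <= b whose ends alternate on its
   boundary line intersect (parity of the crossings of a ray with a closed
   rectilinear polygon).  Applied to the sets K(y) and to the paths above, this
   shows first that k is at most two-to-one, and then that for k(y), k(z) with
   some k(w) strictly in between, the components of k(y) and k(z) in the parts of
   K(y) and K(z) in the strip a <= x <= b are disjoint.  These components are
   nondegenerate continua, so there are only countably many of them. *)
Require Import Defs.
From HB Require Import structures.
From mathcomp Require Import all_boot all_order all_algebra.
From mathcomp Require Import all_classical all_reals all_analysis.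
From mathcomp Require Import lra.
Import numFieldNormedType.Exports.
Set Implicit Arguments. Unset Strict Implicit. Unset Printing Implicit Defensive.
Import Order.TTheory GRing.Theory Num.Theory.
Local Open Scope classical_set_scope.
Local Open Scope ring_scope.

(** * Rectilinear paths and crossing parity *)

Section Rectilinear.
Variable R : realType.
Local Notation plane := (R * R)%type.
Implicit Types (p q u v x y z : plane) (s : seq plane) (A G : set plane).

Definition between (s t z : R) := (s <= z <= t) || (t <= z <= s).

(** The closed box with opposite corners [u] and [v]; a segment only when [axial u v]. *)
Definition seg u v : set plane :=
  [set p | between u.1 v.1 p.1 /\ between u.2 v.2 p.2].

Definition axial u v := (u.1 == v.1) || (u.2 == v.2).

Fixpoint trace x s : set plane :=
  if s is y :: s' then seg x y `|` trace y s' else [set x].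

(** Parity of the crossings with the ray going right from [p], for axial edges. A vertex level with
    [p] counts as below it, so that merely touching the ray contributes an even number. *)
Fixpoint hcross p x s : bool :=
  if s is y :: s'
  then ((p.1 < x.1) && ((x.2 <= p.2) (+) (y.2 <= p.2))) (+) hcross p y s'
  else false.

(** The same parity for the ray going down from [p]. *)
Fixpoint vcross p x s : bool :=
  if s is y :: s'
  then ((x.2 <= p.2) && ((p.1 < x.1) (+) (p.1 < y.1))) (+) vcross p y s'
  else false.

Definition quadrant p u := (p.1 < u.1) && (u.2 <= p.2).

Lemma betweenl (s t : R) : between s t s.
Proof. by rewrite /between !lexx andbT /= le_total. Qed.

Lemma betweenr (s t : R) : between s t t.
Proof. by rewrite /between !lexx andbT /= le_total. Qed.

Lemma betweenC (s t : R) : between s t =1 between t s.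
Proof. by move=> z; rewrite /between orbC. Qed.

Lemma segl u v : seg u v u. Proof. by split; exact: betweenl. Qed.
Lemma segr u v : seg u v v. Proof. by split; exact: betweenr. Qed.

Lemma segC u v : seg u v = seg v u.
Proof. by apply/seteqP; split=> p [p1 p2]; split; rewrite betweenC. Qed.

Lemma axialC u v : axial u v = axial v u.
Proof. by rewrite /axial eq_sym [u.2 == _]eq_sym. Qed.

(** The two rays bound [quadrant p]: an axial edge enters or leaves it exactly when one of the two
    parities counts that edge. *)
Lemma hcrossD_vcross p x s : path axial x s ->
  hcross p x s (+) vcross p x s = quadrant p x (+) quadrant p (last x s).
Proof.
elim: s x => [x _|y s IH x /= /andP[axy pys]] /=; first by rewrite addbb.
have := IH _ pys; rewrite /=; move: (quadrant p (last y s)) => l.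
rewrite /quadrant; move/orP: axy => [] /eqP ->.
  by case: (hcross p y s) (vcross p y s) (p.1 < y.1) (x.2 <= p.2) (y.2 <= p.2) l
    => [] [] [] [] [] [].
by case: (hcross p y s) (vcross p y s) (p.1 < x.1) (p.1 < y.1) (y.2 <= p.2) l
  => [] [] [] [] [] [].
Qed.

Lemma hcross_seg p q x s : path axial x s -> p.2 = q.2 ->
  seg p q `&` trace x s = set0 -> hcross p x s = hcross q x s.
Proof.
move=> + pq2; elim: s x => [//|y s IH x /= /andP[axy pys] dis].
have dis' : seg p q `&` trace y s = set0.
  by apply/seteqP; split=> // z [? ?]; rewrite -dis; split=> //; right.
rewrite -pq2 (IH _ pys dis') {IH}; congr (_ (+) _).
have [xy2|xy2] := eqVneq x.2 y.2; first by rewrite xy2 addbb !andbF.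
have xy1 : x.1 = y.1 by move: axy; rewrite /axial (negbTE xy2) orbF => /eqP.
(* A vertical edge counted for only one of [p] and [q] meets [seg p q] here. *)
apply: contraPP dis => ne; apply/eqP/set0P; exists (x.1, p.2); split; last left.
  split=> /=; last exact: betweenl.
  by move: ne; rewrite /between /=; case: (ltP p.1 x.1) => h1;
    case: (ltP q.1 x.1) => h2 //=; rewrite ?h1 ?h2 ?(ltW h1) ?(ltW h2) ?orbT.
split; rewrite /= ?betweenl //.
by move: ne; rewrite /between; case: (leP x.2 p.2) => h1;
  case: (leP y.2 p.2) => h2 /=; rewrite ?andbF ?(ltW h1) ?(ltW h2) ?orbT.
Qed.

Lemma vcross_seg p q x s : path axial x s -> p.1 = q.1 ->
  seg p q `&` trace x s = set0 -> vcross p x s = vcross q x s.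
Proof.
move=> + pq1; elim: s x => [//|y s IH x /= /andP[axy pys] dis].
have dis' : seg p q `&` trace y s = set0.
  by apply/seteqP; split=> // z [? ?]; rewrite -dis; split=> //; right.
rewrite -pq1 (IH _ pys dis') {IH}; congr (_ (+) _).
have [xy1|xy1] := eqVneq x.1 y.1; first by rewrite xy1 addbb !andbF.
have xy2 : x.2 = y.2 by move: axy; rewrite /axial (negbTE xy1) => /eqP.
apply: contraPP dis => ne; apply/eqP/set0P; exists (p.1, x.2); split; last left.
  split=> /=; first exact: betweenl.
  by move: ne; rewrite /between /=; case: (leP x.2 p.2) => h1;
    case: (leP x.2 q.2) => h2 //=; rewrite ?h1 ?h2 ?(ltW h1) ?(ltW h2) ?orbT.
split; rewrite /= ?betweenl //.
by move: ne; rewrite /between; case: (ltP p.1 x.1) => h1;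
  case: (ltP p.1 y.1) => h2 /=; rewrite ?andbF ?(ltW h1) ?(ltW h2) ?h1 ?h2 ?orbT.
Qed.

(* Around a closed polygon the number of crossings of a horizontal ray has the
   parity of the number of crossings of a vertical ray; the former can only
   change under a vertical move of p, the latter under a horizontal one. *)
Lemma hcross_axial p q x s : path axial x s -> last x s = x -> axial p q ->
  seg p q `&` trace x s = set0 -> hcross p x s = hcross q x s.
Proof.
move=> pxs lxs /orP[] /eqP pq dis; last exact: hcross_seg.
have hv r : hcross r x s = vcross r x s.
  by move: (hcrossD_vcross r pxs); rewrite lxs addbb; case: hcross vcross => [] [].
by rewrite !hv; exact: vcross_seg.
Qed.

Lemma closed_between (s t : R) : closed [set z | between s t z].
Proof.
rewrite (_ : [set _ | _] = `[s, t] `|` `[t, s]); last first.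
  by apply/seteqP; split=> z /=; rewrite /between !in_itv /= => /orP.
by apply: closedU; exact: interval_closed.
Qed.

Lemma closed_fst (D : set R) : closed D -> closed [set p : plane | D p.1].
Proof. by move=> cD; apply: preimage_closed cD => ? _; exact: cvg_fst. Qed.

Lemma closed_snd (D : set R) : closed D -> closed [set p : plane | D p.2].
Proof. by move=> cD; apply: preimage_closed cD => ? _; exact: cvg_snd. Qed.

Lemma closed_seg u v : closed (seg u v).
Proof.
rewrite (_ : seg u v = [set p | between u.1 v.1 p.1] `&`
                       [set p | between u.2 v.2 p.2]) //; apply: closedI.
  exact: (closed_fst (@closed_between _ _)).
exact: (closed_snd (@closed_between _ _)).
Qed.

Lemma closed_trace x s : closed (trace x s).
Proof.
elim: s x => [x|y s IH x] /=; last by apply: closedU => //; exact: closed_seg.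
rewrite (_ : [set x] = seg x x); first exact: closed_seg.
apply/seteqP; split=> [_ ->|[z1 z2] [/=]]; first exact: segl.
by rewrite /between !orbb => /le_anti <- /le_anti <-; case: x.
Qed.

Lemma nbhs_box x A : nbhs x A ->
  exists2 e : R, 0 < e & forall p, `|x.1 - p.1| < e -> `|x.2 - p.2| < e -> A p.
Proof.
by move=> /nbhs_ballP[e e0 h]; exists e => // p p1 p2; apply: h; split.
Qed.

Lemma seg_box (e : R) x p q z : `|x.1 - p.1| < e -> `|x.2 - p.2| < e ->
  `|x.1 - q.1| < e -> `|x.2 - q.2| < e -> seg p q z ->
  `|x.1 - z.1| < e /\ `|x.2 - z.2| < e.
Proof.
rewrite !ltr_distl => /andP[? ?] /andP[? ?] /andP[? ?] /andP[? ?] [].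
by move=> /orP[] /andP[? ?] /orP[] /andP[? ?]; split; apply/andP; split; lra.
Qed.

(** The parity is locally constant off the polygon, so fixing its value cuts out a relatively clopen
    subset of [A]. *)
Lemma hcross_connected A x s p q : path axial x s -> last x s = x ->
  connected A -> A `&` trace x s = set0 -> A p -> A q ->
  hcross p x s = hcross q x s.
Proof.
move=> pxs lxs cA dis Ap Aq.
have oP r : open [set z | ~ trace x s z /\ hcross z x s = r].
  rewrite openE => z [tz rz].
  have /nbhs_box[e e0 he] : nbhs z (~` trace x s).
    by apply: open_nbhs_nbhs; split=> //; apply: closed_openC; exact: closed_trace.
  apply/nbhs_ballP; exists e => //= w [/= w1 w2].
  have zz : `|z.1 - z.1| < e /\ `|z.2 - z.2| < e by rewrite !subrr normr0.
  split; first exact: he.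
  (* In the box, [w] is joined to [z] by two axial moves with corner [(z.1, w.2)]. *)
  have move1 u v : `|z.1 - u.1| < e -> `|z.2 - u.2| < e -> `|z.1 - v.1| < e ->
      `|z.2 - v.2| < e -> axial u v -> hcross u x s = hcross v x s.
    move=> u1 u2 v1 v2 uv; apply: hcross_axial => //.
    by apply/seteqP; split=> // y [/(seg_box u1 u2 v1 v2)[y1 y2]]; exact: he.
  rewrite -rz (move1 w (z.1, w.2)) ?(move1 (z.1, w.2) z) //=; try by case: zz.
    by rewrite /axial /= eqxx.
  by rewrite /axial /= eqxx orbT.
have nt z : A z -> ~ trace x s z by move=> Az tz; rewrite -[False]/(set0 z) -dis.
pose B := A `&` [set z | ~ trace x s z /\ hcross z x s = hcross p x s].
suff AB : B = A by have : B q; [rewrite AB | case=> _ [_ ->]].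
apply: cA.
- by exists p; split=> //; split=> //; exact: nt.
- by exists [set z | ~ trace x s z /\ hcross z x s = hcross p x s].
- exists (~` [set z | ~ trace x s z /\ hcross z x s = ~~ hcross p x s]).
    exact: open_closedC.
  apply/seteqP; split=> z [Az].
    by case=> tz hz; split=> // -[_]; rewrite hz; case: hcross.
  move=> h; split=> //; split; first exact: nt.
  apply/eqP; apply: contrapT => /negP hz; apply: h; split; first exact: nt.
  by move: hz; case: hcross; case: hcross.
Qed.

Lemma trace_head x s : trace x s x.
Proof. by case: s => [//|y s]; left; exact: segl. Qed.

Lemma trace_cat x s s' : trace x (s ++ s') = trace x s `|` trace (last x s) s'.
Proof.
elim: s x => [|y s IH] x /=; last by rewrite IH setUA.
by apply/esym/setUidPr => _ ->; exact: trace_head.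
Qed.

Lemma trace_last x s : trace x s (last x s).
Proof. by elim: s x => [//|y s IH] x; right; exact: IH. Qed.

Lemma hcross_cat p x s s' :
  hcross p x (s ++ s') = hcross p x s (+) hcross p (last x s) s'.
Proof. by elim: s x => [//|y s IH] x /=; rewrite IH addbA. Qed.

Lemma hcross_left p x s : (forall z, trace x s z -> z.1 <= p.1) ->
  hcross p x s = false.
Proof.
elim: s x => [//|y s IH] x h /=; rewrite IH => [|z hz]; last by apply: h; right.
by rewrite ltNge h //; exact: (@trace_head x (y :: s)).
Qed.

(** * Reachability by rectilinear paths inside a set *)

Definition reach G x y :=
  exists s, [/\ path axial x s, last x s = y & trace x s `<=` G].

Lemma reachW G G' x y : G `<=` G' -> reach G x y -> reach G' x y.
Proof. by move=> GG' [s [? ? sG]]; exists s; split=> //; exact: subset_trans GG'. Qed.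

Lemma reach_l G x y : reach G x y -> G x.
Proof. by case=> s [_ _]; apply; exact: trace_head. Qed.

Lemma reach_r G x y : reach G x y -> G y.
Proof. by case=> s [_ <-]; apply; exact: trace_last. Qed.

Lemma reach1 G x y : axial x y -> seg x y `<=` G -> reach G x y.
Proof.
move=> xy sG; exists [:: y]; split=> //=; first by rewrite xy.
by move=> z [/sG//|->]; apply: sG; exact: segr.
Qed.

Lemma reach_refl G x : G x -> reach G x x.
Proof. by move=> Gx; exists [::]; split=> // z ->. Qed.

Lemma reach_trans G x y z : reach G x y -> reach G y z -> reach G x z.
Proof.
move=> [s [ps ls sG]] [s' [ps' ls' sG']]; exists (s ++ s').
by rewrite cat_path ps ls last_cat ls ps' trace_cat ls; split=> // w [/sG|/sG'].
Qed.

Lemma reach_sym G x y : reach G x y -> reach G y x.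
Proof.
case=> s; elim: s x => [|z s IH] x [/=].
  by move=> _ <- sG; apply: reach_refl; exact: sG.
move=> /andP[xz pzs] ls sG; apply: (@reach_trans _ _ z).
  by apply: IH; split=> // w hw; apply: sG; right.
by apply: reach1; [rewrite axialC | rewrite segC => w hw; apply: sG; left].
Qed.

Lemma reach_box G (e : R) x y :
  0 < e -> (forall p, `|x.1 - p.1| < e -> `|x.2 - p.2| < e -> G p) ->
  `|x.1 - y.1| < e -> `|x.2 - y.2| < e -> reach G x y.
Proof.
move=> e0 he xy1 xy2; have z0 (t : R) : `|t - t| < e by rewrite subrr normr0.
apply: (@reach_trans _ _ (y.1, x.2)).
  apply: reach1; first by rewrite /axial /= eqxx orbT.
  by move=> z /(@seg_box e x)[]//= z1 z2; exact: he.
apply: reach1; first by rewrite /axial /= eqxx.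
by move=> z /(@seg_box e x)[]//= z1 z2; exact: he.
Qed.

Lemma reach_open G x : open G -> open [set y | reach G x y].
Proof.
rewrite !openE => oG y xy; have /nbhs_box[e e0 he] := oG _ (reach_r xy).
apply/nbhs_ballP; exists e => //= z [/= z1 z2].
by apply: reach_trans xy _; exact: reach_box he _ _.
Qed.

(** With [reach_open]: reachable points form a relatively clopen subset of an open [G]. *)
Lemma reach_closed G x z : open G -> G z ->
  closure [set y | reach G x y] z -> reach G x z.
Proof.
rewrite openE => oG Gz cz; have /nbhs_box[e e0 he] := oG _ Gz.
have [y [xy [/= y1 y2]]] := cz _ (nbhsx_ballx z e e0).
by apply: reach_trans xy _; apply: reach_sym; exact: reach_box he _ _.
Qed.

Lemma connected_between (s t : R) : connected [set z | between s t z].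
Proof.
apply/connected_intervalP => i j /= ist jst k /andP[ik kj].
move: ist jst; rewrite /between.
by move=> /orP[] /andP[? ?] /orP[] /andP[? ?]; apply/orP;
  (try by left; lra); (try by right; lra).
Qed.

Lemma continuous_pair (T : topologicalType) (f g : T -> R) :
  continuous f -> continuous g -> continuous (fun t => (f t, g t)).
Proof.
move=> cf cg t; apply: (@cvg_pair _ _ _ _ (nbhs (f t)) (nbhs (g t))).
  exact: cf.
exact: cg.
Qed.

Lemma connected_seg u v : axial u v -> connected (seg u v).
Proof.
move=> /orP[] /eqP uv.
- rewrite (_ : seg u v = (fun t : R => (u.1, t)) @` [set t | between u.2 v.2 t]).
    apply: connected_continuous_connected; first exact: connected_between.
    apply: continuous_subspaceT; apply: continuous_pair => t;
      by [exact: cvg_cst | exact: cvg_id].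
  apply/seteqP; split=> [[z1 z2] [/=]|_ [z /= hz <-]].
    by rewrite /between -uv orbb => /le_anti <- ?; exists z2.
  by split=> //=; rewrite -uv; exact: betweenl.
- rewrite (_ : seg u v = (fun t : R => (t, u.2)) @` [set t | between u.1 v.1 t]).
    apply: connected_continuous_connected; first exact: connected_between.
    apply: continuous_subspaceT; apply: continuous_pair => t;
      by [exact: cvg_cst | exact: cvg_id].
  apply/seteqP; split=> [[z1 z2] [/=]|_ [z /= hz <-]].
    by rewrite /between -uv orbb => ? /le_anti <-; exists z1.
  by split=> //=; rewrite -uv; exact: betweenl.
Qed.

Lemma connected_trace x s : path axial x s -> connected (trace x s).
Proof.
elim: s x => [|y s IH] x /=; first by move=> _; exact: connected1.
move=> /andP[xy /IH cs]; apply: connectedU => //; last exact: connected_seg.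
by exists y; split; [exact: segr | exact: trace_head].
Qed.

(** The trace of a path, being closed, can serve as an obstacle for later paths. *)
Lemma reach_arc G x y : reach G x y ->
  exists M, [/\ closed M, connected M, M `<=` G & reach M x y].
Proof.
case=> s [ps ls sG]; exists (trace x s); split=> //; first exact: closed_trace.
  exact: connected_trace.
by exists s; split.
Qed.

Lemma reach_vertical G (b : R) x y : x.1 < b -> b <= y.1 -> reach G x y ->
  exists2 e, e.1 = b & reach (G `&` [set p | p.1 <= b]) x e.
Proof.
move=> xb yb [s]; elim: s x xb => [|z s IH] x xb [/= + ls sG].
  by move: xb; rewrite ls ltNge yb.
have sxz : seg x z `<=` G by move=> w hw; apply: sG; left.
move=> /andP[xz pzs]; have [zb|bz] := ltP z.1 b.
  have [|e eb ze] := IH z zb.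
    by split=> // w hw; apply: sG; right.
  exists e => //; apply: reach_trans ze; apply: reach1 => // w xzw.
  by split; [exact: sxz | case: xzw => /orP[] /andP[? ?] _ /=; lra].
(* The first edge reaching the line is horizontal, so it does so at the height of [x]. *)
exists (b, x.2) => //; apply: reach1; first by rewrite /axial /= eqxx orbT.
have xz2 : x.2 = z.2.
  by move: xz => /orP[/eqP xz1|/eqP//]; move: xb; rewrite xz1 ltNge bz.
move=> [w1 w2] []; rewrite /between /= orbb => h1 /le_anti <-; split=> /=.
  apply: sxz; split=> /=; last exact: betweenl.
  by apply/orP; left; move: h1 => /orP[] /andP[? ?]; lra.
by move: h1 => /orP[] /andP[? ?]; lra.
Qed.

(* The path is closed up by a detour to the right of the vertical line of
   abscissa [b]; a point of that line lies inside the resulting polygon iff its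
   ordinate is between those of the end points. *)
Lemma noncrossing G A (b : R) e f p q :
  reach G e f -> e.1 = b -> f.1 = b -> G `<=` [set z | z.1 <= b] ->
  connected A -> A `<=` [set z | z.1 <= b] -> A `&` G = set0 ->
  A p -> A q -> p.1 = b -> q.1 = b ->
  (e.2 <= p.2) (+) (f.2 <= p.2) = (e.2 <= q.2) (+) (f.2 <= q.2).
Proof.
move=> [s [ps ls sG]] eb fb Gb cA Ab AG Ap Aq pb qb.
pose s' := s ++ [:: (b + 1, f.2); (b + 1, e.2); e].
have ps' : path axial e s'.
  by rewrite cat_path ps ls /= /axial /= !eqxx !orbT.
have ls' : last e s' = e by rewrite last_cat.
(* Only the added edge at abscissa [b + 1] counts: the other two are horizontal, and the original
   path is never to the right of [r]. *)
have hs r : r.1 = b -> hcross r e s' = ((e.2 <= r.2) (+) (f.2 <= r.2)).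
  move=> rb; rewrite hcross_cat hcross_left => [|z hz]; last first.
    by rewrite rb; apply: Gb; exact: sG.
  by rewrite ls /= rb fb ltxx ltrDl ltr01 !addbb /= addbF addbC.
rewrite -!hs //; apply: hcross_connected Ap Aq => //.
apply/seteqP; split=> // z [Az]; rewrite trace_cat ls => -[/sG Gz|].
  by rewrite -AG.
have nG u : G u -> A u -> False by move=> ? ?; rewrite -[False]/(set0 u) -AG.
have Ge : G e by apply: sG; exact: trace_head.
have Gf : G f by rewrite -ls; apply: sG; exact: trace_last.
have zb := Ab _ Az; case: z Az zb => z1 z2 Az /= zb.
have bb (i j : R) : between i i j -> i = j by rewrite /between orbb => /le_anti.
move=> [[]|[[]|[[]|]]] /=; rewrite ?eb ?fb.
- move=> /orP[] /andP[h1 h2] /bb zf; last by have := le_trans h1 h2; rewrite gerDl ler10.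
  apply: (nG f) => //; rewrite (_ : f = (z1, z2)) //.
  by case: (f) fb zf => ? ? /= -> ->; congr pair; apply: le_anti; apply/andP.
- by move=> /bb zb1; move: zb; rewrite -zb1 gerDl ler10.
- move=> /orP[] /andP[h1 h2] /bb ze; first by have := le_trans h1 h2; rewrite gerDl ler10.
  apply: (nG e) => //; rewrite (_ : e = (z1, z2)) //.
  by case: (e) eb ze => ? ? /= -> ->; congr pair; apply: le_anti; apply/andP.
- by move=> E; apply: (nG e) => //; rewrite -E.
Qed.

End Rectilinear.

(** * Components, quasi-components and clopen subsets *)

Section CompactSets.
Variables (R : realType) (T : pseudoMetricType R).
Implicit Types (X Y Z C W : set T) (x y : T).

(** Otherwise the sets [g i] generate a proper filter, and a cluster point of it in [X] lies in
    every [f i] but not in [W]. *)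
Lemma directed_compact_sub (I : Type) (D : set I) (f : I -> set T) X W :
  compact X -> open W -> D !=set0 ->
  (forall i j, D i -> D j -> exists2 k, D k & f k `<=` f i `&` f j) ->
  (forall i, D i -> closed (f i)) ->
  X `&` \bigcap_(i in D) f i `<=` W -> exists2 i, D i & X `&` f i `<=` W.
Proof.
move=> cX oW D0 dir cf capW; apply: contrapT => noi.
pose g i := X `&` f i `&` ~` W.
have FF : Filter (filter_from D g).
  apply: filter_from_filter => // i j Di Dj; have [k Dk kij] := dir _ _ Di Dj.
  by exists k => // z [[Xz /kij[? ?]] ?].
have PF : ProperFilter (filter_from D g).
  apply: filter_from_proper => i Di; apply: contrapT => gi0; apply: noi.
  by exists i => // z Xfz; apply: contrapT => Wz; apply: gi0; exists z.
have [|p [Xp clp]] := cX (filter_from D g) PF.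
  by have [i Di] := D0; exists i => // z [[]].
rewrite clusterE in clp.
have [i0 Di0] := D0; have nWp : (~` W) p.
  rewrite (closure_id (~` W)).1; last exact: open_closedC.
  by apply: clp; exists i0 => // z [].
apply: nWp; apply: capW; split=> // i Di; rewrite (closure_id (f i)).1; last exact: cf.
by apply: clp; exists i => // z [[]].
Qed.

Lemma clopen_inT Y : clopen_in Y Y.
Proof.
split=> //; split; exists setT; rewrite setTI; split=> //.
exact: openT.
Qed.

Lemma clopen_inI Y C C' : clopen_in Y C -> clopen_in Y C' -> clopen_in Y (C `&` C').
Proof.
move=> [CY [[U [oU CU]] [F [cF CF]]]] [_ [[U' [oU' CU']] [F' [cF' CF']]]].
split; first by move=> z [/CY].
split; [exists (U `&` U'); rewrite setIIl -CU -CU' | exists (F `&` F');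
  rewrite setIIl -CF -CF']; split=> //.
  exact: openI.
exact: closedI.
Qed.

Lemma closure_clopen_in Y C : clopen_in Y C -> closure C `&` Y `<=` C.
Proof.
move=> [_ [_ [F [cF CF]]]] z [clz Yz]; rewrite CF; split=> //.
by rewrite (closure_id F).1 //; apply: closureS clz; rewrite CF => w [].
Qed.

(** The last hypothesis keeps the limits that lie in [C] inside [U], which gives relative
    closedness. *)
Lemma clopen_in_openI Y C U : clopen_in Y C -> open U ->
  closure (C `&` U) `&` C `<=` U -> clopen_in Y (C `&` U).
Proof.
move=> cC oU h; have [CY [[V [oV CV]] _]] := cC.
split; first by move=> z [/CY].
split.
  by exists (V `&` U); split; [exact: openI | rewrite setIAC -CV].
exists (closure (C `&` U)); split; first exact: closed_closure.
apply/seteqP; split=> z.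
  by move=> CUz; split; [exact: subset_closure | exact: CY CUz.1].
move=> [clz Yz]; have Cz : C z.
  by apply: (closure_clopen_in cC); split=> //; apply: closureS clz => w [].
by split=> //; apply: h.
Qed.

(* In a compact set components and quasi-components coincide. *)
Lemma connected_component_clopen Z x W : closed Z ->
  compact Z -> Z x -> open W -> connected_component Z x `<=` W ->
  exists U V, [/\ open U, open V, U `&` V = set0, Z `<=` U `|` V & U x /\ U `<=` W].
Proof.
have /(@normal_openP R) sep := @pseudometric_normal R T; move=> clZ cZ Zx oW sW.
pose D := [set C | clopen_in Z C /\ C x].
have DZ : D Z by split; [exact: clopen_inT|].
have dir C C' : D C -> D C' -> exists2 K, D K & K `<=` C `&` C'.
  by move=> [? ?] [? ?]; exists (C `&` C') => //; split; [exact: clopen_inI|].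
have Dcl C : D C -> closed C.
  by move=> [[_ [_ [F [cF ->]]]] _]; exact: closedI.
(* The quasi-component of [x] in [Z]; the point is that it is connected. *)
pose Q := \bigcap_(C in D) C.
have QZ : Q `<=` Z by move=> z; exact.
have cutQ U : open U -> Q `<=` U -> exists2 C, D C & C `<=` U.
  move=> oU QU; have [||C DC CU] := @directed_compact_sub _ D id Z U cZ oU _ dir Dcl.
  - by exists Z.
  - by move=> z [_ Qz]; exact: QU.
  - by exists C => // z Cz; apply: CU; split=> //; exact: DC.1.1.
have clQ : closed Q by apply: closed_bigI => C; exact: Dcl.
(* Normality puts the pieces in disjoint open [U] and [V]. A clopen [C] inside their union is cut by
   [U] in a clopen set containing [x], so [Q] lies in [U]. *)
have split_trivial A B : closed A -> closed B -> A `&` B = set0 ->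
    Q = A `|` B -> A x -> B = set0.
  move=> cA cB AB QAB Ax; have [U [V [oU oV AU BV UV]]] := sep _ _ cA cB AB.
  have [||C [cC Cx] CUV] := cutQ (U `|` V); first exact: openU.
    by rewrite QAB => z [/AU|/BV]; [left|right].
  have QU : Q `<=` C `&` U.
    apply: bigcap_inf; split; last by split=> //; exact: AU.
    apply: clopen_in_openI => // z [clz Cz].
    have [//|Vz] := CUV _ Cz.
    have [w [[_ Uw] Vw]] := clz _ (open_nbhs_nbhs (conj oV Vz)).
    by exfalso; rewrite -[False]/(set0 w) -UV.
  apply/seteqP; split=> // z Bz; rewrite -UV; split; last exact: BV.
  by apply: (QU z _).2; rewrite QAB; right.
have cQ : connected Q.
  move=> B B0 [P oP BP] [F cF BF].
  have cB : closed B by rewrite BF; exact: closedI.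
  have cB' : closed (Q `&` ~` P) by apply: closedI => //; exact: open_closedC.
  have BB' : B `&` (Q `&` ~` P) = set0.
    by rewrite BP; apply/seteqP; split=> // z [[_ ?] [_]].
  have QBB' : Q = B `|` (Q `&` ~` P) by rewrite BP -setIUr setUv setIT.
  have : Q x by move=> C [].
  rewrite {1}QBB' => -[Bx|Bx'].
    by rewrite QBB' (split_trivial _ _ cB cB' BB' QBB' Bx) setU0.
  move: B0; rewrite setIC in BB'; rewrite setUC in QBB'.
  by rewrite (split_trivial _ _ cB' cB BB' QBB' Bx') => -[].
have QW : Q `<=` W.
  by apply: subset_trans sW; apply: connected_component_max => // C [].
have [C [cC Cx] CW] := cutQ _ oW QW.
have [CZ [[P [oP CP]] _]] := cC.
have cC' : closed (Z `&` ~` P) by apply: closedI => //; exact: open_closedC.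
have [||U [V [oU oV CU C'V UV]]] := sep C (Z `&` ~` P) _ cC'.
- exact: Dcl.
- by rewrite {1}CP; apply/seteqP; split=> // z [[? _] [_]].
exists (U `&` W), V; split=> //; first exact: openI.
- by apply/seteqP; split=> // z [[? _] ?]; rewrite -UV.
- move=> z Zz; have [Pz|Pz] := pselect (P z); last by right; apply: C'V.
  have Cz : C z by rewrite CP.
  by left; split; [exact: CU | exact: CW].
- by split=> [|z []//]; split; [exact: CU | exact: CW].
Qed.

End CompactSets.

Section Quasicomponents.
Variables (R : realType) (T : pseudoMetricType R).
Implicit Types (X Y C D W : set T) (x y z : T).

(* The set L(y): not the quasi-component of [y] in [Y], which would be [set y]. *)
Definition qcl Y y : set T :=
  \bigcap_(C in [set C | clopen_in Y C /\ C y]) closure C.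

Lemma qcl_refl Y y : qcl Y y y.
Proof. by move=> C [_ Cy]; exact: subset_closure. Qed.

Lemma closed_qcl Y y : closed (qcl Y y).
Proof. by apply: closed_bigI => C _; exact: closed_closure. Qed.

Lemma qcl_sub X Y y : closed X -> Y `<=` X -> Y y -> qcl Y y `<=` X.
Proof.
move=> cX YX Yy z /(_ Y); rewrite (closure_id X).1 // => h.
by apply: closureS YX _ _; apply: h; split=> //; exact: clopen_inT.
Qed.

Lemma clopen_inD Y C : clopen_in Y C -> clopen_in Y (Y `\` C).
Proof.
move=> [CY [[U [oU CU]] [F [cF CF]]]]; split; first by move=> z [].
have YD V : C = V `&` Y -> Y `\` C = ~` V `&` Y.
  by move=> ->; rewrite setDE setCI setIUr setICr setU0 setIC.
split; [exists (~` F) | exists (~` U)]; split; try exact: YD.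
  exact: closed_openC.
exact: open_closedC.
Qed.

(** If [C] separates [y] from [z], its complement in [Y] is a clopen set around [z] whose closure
    misses [C]. *)
Lemma qcl_disjoint Y y z : tot_disconnected Y -> Y y -> Y z -> y <> z ->
  exists C, [/\ clopen_in Y C, C y & C `&` qcl Y z = set0].
Proof.
move=> tY Yy Yz yz; have [C [cC [Cy Cz]]] := tY _ _ Yy Yz yz.
exists C; split=> //; apply/seteqP; split=> // w [Cw qw].
have cD := clopen_inD cC.
have [] : (Y `\` C) w => //.
by apply: (closure_clopen_in cD); split; [apply: qw | exact: cC.1].
Qed.

(** The closures defining [qcl Y y] are directed, so by compactness one of them already works. *)
Lemma qcl_shrink X Y D W y : compact X -> closed X -> Y `<=` X -> Y y ->
  closed D -> open W -> qcl Y y `&` D `<=` W ->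
  exists C, [/\ clopen_in Y C, C y & closure C `&` D `<=` W].
Proof.
move=> cX clX YX Yy cD oW qW.
have [||||C [cC Cy] CW] :=
    @directed_compact_sub R T _ [set C | clopen_in Y C /\ C y] closure (X `&` D) W
    (compact_closedI cX cD) oW.
- by exists Y; split=> //; exact: clopen_inT.
- move=> C C' [cC Cy] [cC' C'y]; exists (C `&` C').
    by split=> //; exact: clopen_inI.
  by move=> z h; split; apply: closureS h => ? [].
- by move=> C _; exact: closed_closure.
- by move=> z [[Xz Dz] qz]; apply: qW.
- exists C; split=> // z [clz Dz]; apply: CW; split=> //; split=> //.
  rewrite (closure_id X).1 //; apply: closureS clz.
  by apply: subset_trans YX; exact: cC.1.
Qed.

(** Were [qcl Y y] a single point, [qcl_shrink] would give arbitrarily small clopen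
    neighbourhoods. *)
Lemma Lambda_qcl X Y y : compact X -> closed X -> Y `<=` X -> Lambda Y y ->
  exists2 z, qcl Y y z & z <> y.
Proof.
move=> cX clX YX [Yy]; apply: contra_notP => noz V.
rewrite nbhsE => -[U [oU Uy] UV].
have [|C [cC Cy CU]] := @qcl_shrink X Y setT U y cX clX YX Yy closedT oU.
  move=> z [qz _]; have [->//|zy] := pselect (z = y).
  by exfalso; apply: noz; exists z.
exists C; split=> //; split=> // z Cz; split; last exact: cC.1.
by apply: UV; apply: CU; split=> //; exact: subset_closure.
Qed.

End Quasicomponents.

(** * Points with a quasi-component crossing a strip *)

Lemma compact_plane_closed (R : realType) (X : set (R * R)%type) :
  compact X -> closed X.
Proof. by apply: compact_closed; exact: norm_hausdorff. Qed.

Section HalfPlane.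
Variables (R : realType).
Local Notation plane := (R * R)%type.
Variables (X Y : set plane) (a b : R).
Hypotheses (cptX : compact X) (YX : Y `<=` X) (tdY : tot_disconnected Y).
Hypothesis (ab : a < b).
Implicit Types (p q y w z k e f : plane) (G M A B : set plane).

Local Notation H := [set p : plane | p.1 <= b].
Local Notation K y := (connected_component (qcl Y y `&` H) y).

Definition far y := [/\ Y y, y.1 < a & exists2 q, qcl Y y q & b < q.1].

(* Neighbourhoods of [K y] and complements of the sets [qcl Y z], [z <> y],
   both belong to this class, which is stable under intersection. *)
Definition admissible y G := open G /\ exists P C,
  [/\ open P, K y `<=` P, clopen_in Y C, C y & P `&` C `<=` G].

(** The last clause makes [k] a cluster point of path ends along the filter generated by admissible
    sets. *)
Definition endpoint y k := [/\ k.1 = b, K y k & forall G (d : R),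
  admissible y G -> 0 < d ->
  exists e, [/\ e.1 = b, `|k.2 - e.2| < d & reach (G `&` H) y e]].

Lemma closed_half : closed H.
Proof. exact: (closed_fst (@closed_le R b)). Qed.

Lemma far_half y : far y -> H y.
Proof. by case=> _ ya _ /=; exact/ltW/(lt_trans ya). Qed.

Lemma K_qcl y : K y `<=` qcl Y y `&` H.
Proof. exact: connected_component_sub. Qed.

Lemma K_refl y : far y -> K y y.
Proof.
move=> fy; apply: connected_component_refl; split; first exact: qcl_refl.
exact: far_half.
Qed.

Lemma closed_K y : closed (K y).
Proof.
by apply: component_closed; apply: closedI; [exact: closed_qcl | exact: closed_half].
Qed.

Lemma qcl_X y : far y -> qcl Y y `<=` X.
Proof. by case=> Yy _ _; apply: qcl_sub => //; exact: compact_plane_closed. Qed.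

Lemma admissibleI y G G' :
  admissible y G -> admissible y G' -> admissible y (G `&` G').
Proof.
move=> [oG [P [C [oP KP cC Cy PCG]]]] [oG' [P' [C' [oP' KP' cC' C'y PCG']]]].
split; first exact: openI.
exists (P `&` P'), (C `&` C'); split => //.
- exact: openI.
- by move=> z Kz; split; [exact: KP | exact: KP'].
- exact: clopen_inI.
- by move=> z [[Pz P'z] [Cz C'z]]; split; [exact: PCG | exact: PCG'].
Qed.

Lemma admissible_open y G : Y y -> open G -> K y `<=` G -> admissible y G.
Proof.
move=> Yy oG KG; split=> //; exists G, Y; split=> //; exact: clopen_inT.
Qed.

Lemma admissible_qclC y z : Y y -> Y z -> y <> z -> admissible y (~` qcl Y z).
Proof.
move=> Yy Yz yz; split; first by apply: closed_openC; exact: closed_qcl.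
have [C [cC Cy Cz]] := qcl_disjoint tdY Yy Yz yz.
exists setT, C; split=> //; first exact: openT.
by move=> w [_ Cw] qw; rewrite -[False]/(set0 w) -Cz.
Qed.

Lemma admissibleC y B : far y -> closed B -> B `&` K y = set0 ->
  admissible y (~` B).
Proof.
move=> [Yy _ _] cB BK; apply: admissible_open => //; first exact: closed_openC.
by move=> z Kz Bz; rewrite -[False]/(set0 z) -BK.
Qed.

(* Otherwise the points reachable from [y] inside [G], near [K y], would cut out
   of [Y] a clopen neighbourhood of [y] contained in the half-plane. *)
Lemma admissible_reach y G : far y -> admissible y G ->
  exists2 e, e.1 = b & reach (G `&` H) y e.
Proof.
move=> fy [oG [P [C [oP KP cC Cy PCG]]]]; have [Yy ya [q qyq bq]] := fy.
have cZ : compact (qcl Y y `&` H).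
  apply: (subclosed_compact _ cptX); last by move=> z [/(qcl_X fy)].
  by apply: closedI; [exact: closed_qcl | exact: closed_half].
have Zy : (qcl Y y `&` H) y by split; [exact: qcl_refl | exact: far_half].
have clZ : closed (qcl Y y `&` H).
  by apply: closedI; [exact: closed_qcl | exact: closed_half].
have [U [V [oU oV UV ZUV [Uy UP]]]] := connected_component_clopen clZ cZ Zy oP KP.
have [D [cD Dy DUV]] := qcl_shrink cptX (compact_plane_closed cptX) YX Yy
  closed_half (openU oU oV) ZUV.
have oGU : open (G `&` U) by exact: openI.
have GUy : (G `&` U) y by split=> //; apply: PCG; split=> //; exact: UP.
pose S := [set z | reach (G `&` U) y z].
have [[z yz bz]|noz] := pselect (exists2 z, reach (G `&` U) y z & b <= z.1).
  have [|e eb ye] := reach_vertical _ bz yz; first exact: lt_trans ab.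
  by exists e => //; apply: reachW ye => w [[? ?] ?].
have SH : S `<=` H.
  move=> z yz; rewrite /= leNgt; apply/negP => bz; apply: noz.
  by exists z => //; exact: ltW.
(* A limit of these points lying in [C] and [D] is in the half-plane, hence in [U] or [V]; as [S]
   lies in [U], it is in [U], hence in [G], hence reachable. *)
have cE : clopen_in Y ((C `&` D) `&` S).
  apply: clopen_in_openI; [exact: clopen_inI | exact: reach_open |].
  move=> z [clz [Cz Dz]].
  have clSz : closure S z by apply: closureS clz => ? [].
  have Hz : H z by rewrite (closure_id H).1; [exact: closureS clSz | exact: closed_half].
  have Uz : U z.
    have [//|Vz] := DUV z (conj (@subset_closure _ _ _ Dz) Hz).
    have [w [/reach_r[_ Uw] Vw]] := clSz _ (open_nbhs_nbhs (conj oV Vz)).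
    by exfalso; rewrite -[False]/(set0 w) -UV.
  apply: reach_closed => //; split=> //.
  by apply: PCG; split=> //; exact: UP.
(* [q] is in the closure of every clopen set around [y], in particular of this one; but
   [b < q.1]. *)
have : H q.
  rewrite (closure_id H).1; last exact: closed_half.
  apply: (@closureS _ ((C `&` D) `&` S)); first by move=> z [_ /SH].
  by apply: qyq; split=> //; split=> //; exact: reach_refl.
by rewrite /= leNgt bq.
Qed.

Lemma bounded_plane : exists2 N : R, 0 < N & forall p, X p -> `|p.2| < N.
Proof.
have : compact (snd @` X).
  apply: continuous_compact cptX; apply: continuous_subspaceT => p.
  exact: cvg_snd.
move=> /compact_bounded[M [_ hM]]; exists (`|M| + 1 + 1).
  by rewrite addr_gt0 // ltr_wpDl.
have M1 : M < `|M| + 1 by rewrite ltr_pwDr // ler_norm.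
move=> p Xp; rewrite ltr_pwDr //; apply: (hM _ M1 p.2).
by exists p.
Qed.

Lemma endpoint_exists y : far y -> exists k, endpoint y k.
Proof.
move=> fy; have [Yy _ _] := fy; have [N N0 XN] := bounded_plane.
pose E G := [set t : R | reach (G `&` H) y (b, t)].
pose F := filter_from (admissible y) E.
have KX z : K y z -> X z by move=> /K_qcl[qz _]; exact: qcl_X fy _ qz.
have aT : admissible y setT by apply: admissible_open => //; exact: openT.
have FF : Filter F.
  apply: filter_from_filter; first by exists setT.
  move=> G G' aG aG'; exists (G `&` G'); first exact: admissibleI.
  by move=> t h; split; apply: reachW h => w [[]].
have PF : ProperFilter F.
  apply: filter_from_proper => G aG; have [[e1 e2] /= eb ye] := admissible_reach fy aG.
  by exists e2; rewrite /E /= (_ : (b, e2) = (e1, e2)) // eb.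
have aN : admissible y [set p | `|p.2| < N].
  apply: admissible_open => //; last by move=> z /KX /XN.
  rewrite (_ : [set _ | _] = ~` [set p : plane | (~` ball (0 : R) N) p.2]).
    apply: closed_openC; apply: (closed_snd (D := ~` ball (0 : R) N)).
    by apply: open_closedC; exact: ball_open.
  by rewrite -ball_normE; apply/seteqP; split=> p /=; rewrite sub0r normrN ?notK.
have [|t [_ clt]] := @segment_compact R (- N) N F PF.
  exists [set p | `|p.2| < N] => // t /reach_r[/= tN _].
  by rewrite in_itv /= -ler_norml ltW.
have near G (d : R) : admissible y G -> 0 < d ->
    exists e, [/\ e.1 = b, `|t - e.2| < d & reach (G `&` H) y e].
  move=> aG d0; have [||u [Eu tu]] := clt (E G) (ball t d); first by exists G.
    exact: nbhsx_ballx.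
  by exists (b, u).
exists (b, t); split=> //.
have [//|nK] := pselect (K y (b, t)).
have /nbhs_box[d d0 hd] : nbhs (b, t) (~` K y).
  by apply: open_nbhs_nbhs; split=> //; apply: closed_openC; exact: closed_K.
(* Off [K y], a small box around the cluster point could be avoided by an admissible set, whose
   paths would then have no end near [t]. *)
pose B := seg (b - d / 2, t - d / 2) (b + d / 2, t + d / 2).
have cB : closed B by exact: closed_seg.
have BK : B `&` K y = set0.
  apply/seteqP; split=> // z [[]]; rewrite /between /= => z1 z2 Kz.
  by apply: (hd z) => //=; rewrite ltr_distl; apply/andP;
    move: z1 z2 => /orP[] /andP[? ?] /orP[] /andP[? ?]; split; lra.
have d2 : 0 < d / 2 by rewrite divr_gt0.
have [e [eb te /reach_r[/= nB _]]] := near _ _ (admissibleC fy cB BK) d2.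
exfalso; apply: nB; move: te; rewrite ltr_distl => /andP[te et].
by split; rewrite /between /= ?eb; apply/orP; left; apply/andP; split; lra.
Qed.

Lemma endpoint_avoiding y k B (d : R) :
  endpoint y k -> admissible y (~` B) -> 0 < d ->
  exists M e, [/\ closed M, connected M, M `<=` H, M `&` B = set0 &
    [/\ e.1 = b, `|k.2 - e.2| < d & reach M y e]].
Proof.
move=> [_ _ hk] aB d0; have [e [eb ke /reach_arc[M [cM coM MB ye]]]] := hk _ _ aB d0.
exists M, e; split=> //; first by move=> z /MB[].
by apply/seteqP; split=> // z [/MB[]].
Qed.

(* Were [e] and [e'] on the same side of [k], the one nearer to [k] would be
   separated from the rest of the line by the other connected set. *)
Lemma opposite_sides A A' B B' k e e' f f' (d : R) :
  connected A -> connected A' -> A `<=` H -> A' `<=` H -> B `<=` H -> B' `<=` H ->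
  A k -> A' k -> A e -> A' e' -> reach B e f -> reach B' e' f' ->
  A `&` B' = set0 -> A' `&` B = set0 ->
  k.1 = b -> e.1 = b -> e'.1 = b -> f.1 = b -> f'.1 = b ->
  `|k.2 - e.2| < d -> `|k.2 - e'.2| < d -> d <= `|k.2 - f.2| -> d <= `|k.2 - f'.2| ->
  (k.2 < e.2) = ~~ (k.2 < e'.2).
Proof.
move=> cA cA' AH A'H BH B'H Ak A'k Ae A'e' ef e'f' AB' A'B kb eb e'b fb f'b.
have neq p q : p.1 = b -> q.1 = b -> p.2 = q.2 -> p = q.
  by case: p q => ? ? [? ?] /= -> -> ->.
have no_meet C D z : C `&` D = set0 -> C z -> D z -> False.
  by move=> CD ? ?; rewrite -[False]/(set0 z) -CD.
have ke : k.2 != e.2.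
  apply/eqP => /neq E; apply: (no_meet _ _ e A'B); last exact: reach_l ef.
  by rewrite -E.
have ke' : k.2 != e'.2.
  apply/eqP => /neq E; apply: (no_meet _ _ e' AB'); last exact: reach_l e'f'.
  by rewrite -E.
have ee' : e.2 != e'.2.
  apply/eqP => /neq E; apply: (no_meet _ _ e A'B); last exact: reach_l ef.
  by rewrite E.
have := noncrossing ef eb fb BH cA' A'H A'B A'k A'e' kb e'b.
have := noncrossing e'f' e'b f'b B'H cA AH AB' Ak Ae kb eb.
move=> h' h he he' hf hf'.
(* A far end is on the same side of [k] and of any point within [d], so its terms cancel in both
   parity equations. *)
have far_le (r s : R) : `|k.2 - r| < d -> d <= `|k.2 - s| -> (s <= k.2) = (s <= r).
  rewrite ltr_distl => /andP[r1 r2]; rewrite ler_normr => /orP[] ks.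
    by rewrite !(@ltW _ _ s) //; lra.
  by rewrite !leNgt; congr (~~ _); apply/idP/idP=> _; lra.
move: h; rewrite (far_le _ _ he' hf) => /addIb h.
move: h'; rewrite (far_le _ _ he hf') => /addIb h'.
by rewrite ltNge h -ltNge [k.2 < e'.2]ltNge h' negbK lt_neqAle eq_sym ee'.
Qed.

(** [opposite_sides] for the connected sets [K y] extended by [N], and the paths from [e] back to
    [y] in [N] and on to [f] in [M]. *)
Lemma opposite_ends y y' k M M' N N' e e' f f' (d : R) :
  far y -> far y' -> endpoint y k -> endpoint y' k ->
  connected N -> connected N' ->
  [/\ M `<=` H, M' `<=` H, N `<=` H & N' `<=` H] ->
  [/\ reach M y f, reach M' y' f', reach N y e & reach N' y' e'] ->
  (M `|` N) `&` qcl Y y' = set0 -> (M' `|` N') `&` qcl Y y = set0 ->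
  [/\ N `&` N' = set0, N `&` M' = set0 & N' `&` M = set0] ->
  [/\ e.1 = b, e'.1 = b, f.1 = b & f'.1 = b] ->
  [/\ `|k.2 - e.2| < d, `|k.2 - e'.2| < d, d <= `|k.2 - f.2| & d <= `|k.2 - f'.2|] ->
  (k.2 < e.2) = ~~ (k.2 < e'.2).
Proof.
move=> fy fy' [kb Kyk _] [_ Ky'k _] cN cN' [MH M'H NH N'H] [yf y'f' ye y'e'].
move=> MNq M'N'q [NN' NM' N'M] [eb e'b fb f'b] [ke ke' kf kf'].
have KH z : K z `<=` H by move=> w /K_qcl[].
have cU z L : far z -> connected L -> L z -> connected (K z `|` L).
  move=> fz cL Lz; apply: connectedU => //; last exact: component_connected.
  by exists z; split=> //; exact: K_refl.
have dis z P Q Q' : (P `|` Q) `&` qcl Y z = set0 -> Q' `&` Q = set0 ->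
    Q' `&` P = set0 -> (K z `|` Q') `&` (Q `|` P) = set0.
  move=> PQz Q'Q Q'P; apply/seteqP; split=> // w [[/K_qcl[zw _]|Q'w] [Qw|Pw]].
  - by rewrite -PQz; split=> //; right.
  - by rewrite -PQz; split=> //; left.
  - by rewrite -Q'Q.
  - by rewrite -Q'P.
apply: (@opposite_sides (K y `|` N) (K y' `|` N') (N `|` M) (N' `|` M')
  k e e' f f' d) => //.
- by apply: cU => //; exact: reach_l ye.
- by apply: cU => //; exact: reach_l y'e'.
- by move=> z [/KH|/NH].
- by move=> z [/KH|/N'H].
- by move=> z [/NH|/MH].
- by move=> z [/N'H|/M'H].
- by left.
- by left.
- by right; exact: reach_r ye.
- by right; exact: reach_r y'e'.
- apply: (@reach_trans _ _ _ y); first by apply: reachW (reach_sym ye); exact: subsetUl.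
  by apply: reachW yf; exact: subsetUr.
- apply: (@reach_trans _ _ _ y'); first by apply: reachW (reach_sym y'e'); exact: subsetUl.
  by apply: reachW y'f'; exact: subsetUr.
- exact: dis.
- by apply: dis; rewrite // setIC.
Qed.

(* Each point gets a first path M, and then a second one N ending closer to k
   and avoiding the previously chosen paths of the other points; two of the
   three ends of the second paths are on the same side of k. *)
Lemma no_common_endpoint k y1 y2 y3 :
  far y1 -> far y2 -> far y3 -> y1 <> y2 -> y1 <> y3 -> y2 <> y3 ->
  endpoint y1 k -> endpoint y2 k -> endpoint y3 k -> False.
Proof.
move=> F1 F2 F3 n12 n13 n23 E1 E2 E3.
have [Y1 _ _] := F1; have [Y2 _ _] := F2; have [Y3 _ _] := F3.
have qk y : endpoint y k -> qcl Y y k by move=> [_ /K_qcl[]].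
have admU y B B' : admissible y (~` B) -> admissible y (~` B') ->
    admissible y (~` (B `|` B')) by rewrite setCU; exact: admissibleI.
have adm y y' y'' B : far y -> Y y' -> Y y'' -> y <> y' -> y <> y'' ->
    closed B -> B `&` qcl Y y = set0 ->
    admissible y (~` (B `|` (qcl Y y' `|` qcl Y y''))).
  move=> fy Yy' Yy'' n' n'' cB Bq; have [Yy _ _] := fy.
  apply: (admU); last by apply: (admU); exact: admissible_qclC.
  apply: admissibleC => //; apply/seteqP; split=> // z [Bz /K_qcl[qz _]].
  by rewrite -Bq.
have adm0 y y' y'' : far y -> Y y' -> Y y'' -> y <> y' -> y <> y'' ->
    admissible y (~` (qcl Y y' `|` qcl Y y'')).
  move=> fy Yy' Yy'' n' n''; rewrite -[_ `|` _]set0U.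
  by apply: adm => //; [exact: closed0 | rewrite set0I].
have sub0 (B C D : set plane) : B `&` C = set0 -> D `<=` C -> B `&` D = set0.
  by move=> BC DC; apply/seteqP; split=> // z [Bz /DC Cz]; rewrite -BC.
have U0 (B C D : set plane) : B `&` D = set0 -> C `&` D = set0 -> (B `|` C) `&` D = set0.
  by move=> BD CD; rewrite setIUl BD CD setU0.
have [M1 [f1 [cM1 _ M1H d1 [f1b _ r1]]]] :=
  endpoint_avoiding E1 (adm0 _ _ _ F1 Y2 Y3 n12 n13) ltr01.
have [M2 [f2 [cM2 _ M2H d2 [f2b _ r2]]]] :=
  endpoint_avoiding E2 (adm0 _ _ _ F2 Y1 Y3 (nesym n12) n23) ltr01.
have [M3 [f3 [cM3 _ M3H d3 [f3b _ r3]]]] :=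
  endpoint_avoiding E3 (adm0 _ _ _ F3 Y1 Y2 (nesym n13) (nesym n23)) ltr01.
have M12 := sub0 _ _ (qcl Y y2) d1 (@subsetUl _ _ _).
have M13 := sub0 _ _ (qcl Y y3) d1 (@subsetUr _ _ _).
have M21 := sub0 _ _ (qcl Y y1) d2 (@subsetUl _ _ _).
have M23 := sub0 _ _ (qcl Y y3) d2 (@subsetUr _ _ _).
have M31 := sub0 _ _ (qcl Y y1) d3 (@subsetUl _ _ _).
have M32 := sub0 _ _ (qcl Y y2) d3 (@subsetUr _ _ _).
(* [k] lies in all three sets [qcl], while each first path avoids two of them and so cannot end at
   [k]. *)
have kf y M f : M `&` qcl Y y = set0 -> endpoint y k -> f.1 = b -> M f ->
    0 < `|k.2 - f.2|.
  move=> Mq Ey fb Mf; rewrite normr_gt0 subr_eq0; apply/eqP => kf2.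
  have [kb _ _] := Ey; suff E : k = f by rewrite -[False]/(set0 k) -Mq; split;
    [rewrite E | exact: qk].
  by rewrite [k]surjective_pairing [f]surjective_pairing kf2 kb fb.
(* Second paths will end closer to [k] than every first path. *)
pose d := Num.min `|k.2 - f1.2| (Num.min `|k.2 - f2.2| `|k.2 - f3.2|).
have d0 : 0 < d.
  by rewrite !lt_min (kf _ _ _ M12 E2 f1b (reach_r r1))
    (kf _ _ _ M21 E1 f2b (reach_r r2)) (kf _ _ _ M31 E1 f3b (reach_r r3)).
have df1 : d <= `|k.2 - f1.2| by rewrite !ge_min lexx.
have df2 : d <= `|k.2 - f2.2| by rewrite !ge_min lexx !orbT.
have df3 : d <= `|k.2 - f3.2| by rewrite !ge_min lexx !orbT.
have [N1 [e1 [cN1 oN1 N1H d4 [e1b ke1 s1]]]] := endpoint_avoiding E1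
  (adm _ _ _ _ F1 Y2 Y3 n12 n13 (closedU cM2 cM3) (U0 _ _ _ M21 M31)) d0.
have N1q2 : N1 `&` qcl Y y2 = set0 by apply: sub0 d4 _ => z; right; left.
have N1q3 : N1 `&` qcl Y y3 = set0 by apply: sub0 d4 _ => z; right; right.
have N1M2 : N1 `&` M2 = set0 by apply: sub0 d4 _ => z; left; left.
have N1M3 : N1 `&` M3 = set0 by apply: sub0 d4 _ => z; left; right.
have [N2 [e2 [cN2 oN2 N2H d5 [e2b ke2 s2]]]] := endpoint_avoiding E2
  (adm _ _ _ _ F2 Y1 Y3 (nesym n12) n23 (closedU cM1 (closedU cM3 cN1))
    (U0 _ _ _ M12 (U0 _ _ _ M32 N1q2))) d0.
have N2q1 : N2 `&` qcl Y y1 = set0 by apply: sub0 d5 _ => z; right; left.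
have N2q3 : N2 `&` qcl Y y3 = set0 by apply: sub0 d5 _ => z; right; right.
have N2M1 : N2 `&` M1 = set0 by apply: sub0 d5 _ => z; left; left.
have N2M3 : N2 `&` M3 = set0 by apply: sub0 d5 _ => z; left; right; left.
have N12 : N1 `&` N2 = set0 by rewrite setIC; apply: sub0 d5 _ => z; left; right; right.
have [N3 [e3 [cN3 oN3 N3H d6 [e3b ke3 s3]]]] := endpoint_avoiding E3
  (adm _ _ _ _ F3 Y1 Y2 (nesym n13) (nesym n23)
    (closedU (closedU cM1 cM2) (closedU cN1 cN2))
    (U0 _ _ _ (U0 _ _ _ M13 M23) (U0 _ _ _ N1q3 N2q3))) d0.
have N3q1 : N3 `&` qcl Y y1 = set0 by apply: sub0 d6 _ => z; right; left.
have N3q2 : N3 `&` qcl Y y2 = set0 by apply: sub0 d6 _ => z; right; right.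
have N3M1 : N3 `&` M1 = set0 by apply: sub0 d6 _ => z; left; left; left.
have N3M2 : N3 `&` M2 = set0 by apply: sub0 d6 _ => z; left; left; right.
have N13 : N1 `&` N3 = set0 by rewrite setIC; apply: sub0 d6 _ => z; left; right; left.
have N23 : N2 `&` N3 = set0 by rewrite setIC; apply: sub0 d6 _ => z; left; right; right.
have o12 := opposite_ends F1 F2 E1 E2 oN1 oN2 (And4 M1H M2H N1H N2H)
  (And4 r1 r2 s1 s2) (U0 _ _ _ M12 N1q2) (U0 _ _ _ M21 N2q1)
  (And3 N12 N1M2 N2M1) (And4 e1b e2b f1b f2b) (And4 ke1 ke2 df1 df2).
have o13 := opposite_ends F1 F3 E1 E3 oN1 oN3 (And4 M1H M3H N1H N3H)
  (And4 r1 r3 s1 s3) (U0 _ _ _ M13 N1q3) (U0 _ _ _ M31 N3q1)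
  (And3 N13 N1M3 N3M1) (And4 e1b e3b f1b f3b) (And4 ke1 ke3 df1 df3).
have o23 := opposite_ends F2 F3 E2 E3 oN2 oN3 (And4 M2H M3H N2H N3H)
  (And4 r2 r3 s2 s3) (U0 _ _ _ M23 N2q3) (U0 _ _ _ M32 N3q2)
  (And3 N23 N2M3 N3M2) (And4 e2b e3b f2b f3b) (And4 ke2 ke3 df2 df3).
by move: o12 o13 o23; case: (k.2 < e1.2) (k.2 < e2.2) (k.2 < e3.2) => [] [] [].
Qed.

(** Boundary bumping: as [K y] joins [k] to [y], on the left of the strip, the component of [k] in
    the strip reaches the line of abscissa [a]. *)
Lemma endpoint_continuum y k : far y -> endpoint y k ->
  exists J : set plane, [/\ continuum J, Defs.nondegenerate J,
    J `<=` K y `&` [set p | a <= p.1] & J k].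
Proof.
move=> fy [kb Kk _]; have [_ ya _] := fy.
pose Z := K y `&` [set p | a <= p.1].
have clZ : closed Z.
  by apply: closedI; [exact: closed_K | exact: (closed_fst (@closed_ge R a))].
have cZ : compact Z.
  by apply: (subclosed_compact clZ cptX) => z [/K_qcl[qz _] _]; exact: qcl_X fy _ qz.
have Zk : Z k by split=> //=; rewrite kb ltW.
have Jk := connected_component_refl Zk.
exists (connected_component Z k); split=> //.
- split; first by exists k.
  split; last exact: component_connected.
  apply: (subclosed_compact (component_closed clZ) cZ).
  exact: connected_component_sub.
- pose W : set plane := [set p | a < p.1].
  have oW : open W.
    rewrite (_ : W = ~` [set p : plane | p.1 <= a]).
      by apply: closed_openC; exact: (closed_fst (@closed_le R a)).
    by apply/seteqP; split=> z /=; rewrite /W /= ltNge => /negP.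
  have [z Jz az] : exists2 z, connected_component Z k z & z.1 <= a.
    apply: contrapT => noz.
    have JW : connected_component Z k `<=` W.
      by move=> z Jz; rewrite /W /= ltNge; apply/negP => za; apply: noz; exists z.
    have [U [V [oU oV UV ZUV [Uk UW]]]] := connected_component_clopen clZ cZ Zk oW JW.
    (* [U] is relatively clopen in [K y]: the rest of [K y] lies in [V] or to the left of the
       strip. *)
    suff KU : K y `&` U = K y.
      have : (K y `&` U) y by rewrite KU; exact: K_refl.
      by case=> _ /UW; rewrite /W /= ltNge (ltW ya).
    apply: (@component_connected _ (qcl Y y `&` H) y).
    + by exists k.
    + by exists U.
    + exists (~` (V `|` [set p | p.1 < a])).
        apply: open_closedC; apply: openU => //.
        rewrite (_ : [set p | _] = ~` [set p : plane | a <= p.1]).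
          by apply: closed_openC; exact: (closed_fst (@closed_ge R a)).
        by apply/seteqP; split=> z /=; rewrite ltNge => /negP.
      apply/seteqP; split=> z [Kz h]; split=> //.
        case=> [Vz|/= za]; first by rewrite -[False]/(set0 z) -UV.
        by have := lt_trans za (UW _ h); rewrite ltxx.
      have [za|az] := ltP z.1 a; first by exfalso; apply: h; right.
      by have [//|Vz] := ZUV z (conj Kz az); exfalso; apply: h; left.
  exists k, z; split=> //; split=> // kz.
  by move: az; rewrite -kz kb leNgt ab.
- exact: connected_component_sub.
Qed.

(* A path from [w], continued vertically on the left of the strip and then above
   [X], separates [k] from [m]. *)
Lemma disjoint_between y w z k l m J L :
  far y -> far w -> far z -> w <> y -> w <> z -> endpoint y k -> endpoint w l ->
  endpoint z m -> k.2 < l.2 -> l.2 < m.2 -> continuum J -> continuum L ->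
  J `<=` K y `&` [set p | a <= p.1] -> L `<=` K z `&` [set p | a <= p.1] ->
  J k -> L m -> J `&` L = set0.
Proof.
move=> fy fw fz wy wz [kb Kyk _] Ew [mb Kzm _] kl lm [_ [_ cJ]] [_ [_ cL]] JK LK Jk Lm.
apply: contrapT => /eqP/set0P JL.
have [Yy _ _] := fy; have [Yw wa _] := fw; have [Yz _ _] := fz.
have [N N0 XN] := bounded_plane.
(* If [J] and [L] meet, this is a connected set containing [k] and [m]. *)
pose A := J `|` L.
have cA : connected A by exact: connectedU.
have Aq z' : A z' -> [/\ (qcl Y y `|` qcl Y z) z', z'.1 <= b, a <= z'.1 & `|z'.2| < N].
  move=> [/JK[/K_qcl[q ?] ?]|/LK[/K_qcl[q ?] ?]]; split=> //.
  - by left.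
  - by apply: XN; exact: qcl_X fy _ q.
  - by right.
  - by apply: XN; exact: qcl_X fz _ q.
have aG : admissible w (~` (qcl Y y `|` qcl Y z)).
  by rewrite setCU; apply: admissibleI; exact: admissible_qclC.
(* This tolerance puts the end [e] of the path strictly between [k] and [m]. *)
have d0 : 0 < Num.min (l.2 - k.2) (m.2 - l.2) by rewrite lt_min !subr_gt0 kl.
have [_ _ hw] := Ew; have [e [eb]] := hw _ _ aG d0.
rewrite lt_min !ltr_distl => /andP[/andP[_ e1] /andP[e2 _]] we.
pose G := H `\` A.
have Ge : reach G e w.
  apply: reach_sym; apply: reachW we => p [nq Hp]; split=> // /Aq[q _ _ _].
  exact: nq.
have Gw : reach G w (w.1, N).
  apply: reach1; first by rewrite /axial /= eqxx.
  move=> p [/= pw _]; have pw1 : p.1 = w.1.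
    by move: pw; rewrite /between orbb => /le_anti.
  split=> [/=|/Aq[_ _ + _]]; first by rewrite pw1 ltW // (lt_trans wa).
  by rewrite pw1 leNgt wa.
have Gf : reach G (w.1, N) (b, N).
  apply: reach1; first by rewrite /axial /= eqxx orbT.
  move=> p [/= pw pN]; have pN2 : p.2 = N.
    by move: pN; rewrite /between orbb => /le_anti.
  split=> [/=|/Aq[_ _ _]]; last by rewrite pN2 gtr0_norm // ltxx.
  by have := lt_trans wa ab; move: pw => /orP[] /andP[] *; lra.
have Ak : A k by left.
have Am : A m by right.
have fk : k.2 < N by have [_ _ _] := Aq _ Ak; exact: le_lt_trans (ler_norm _).
have fm : m.2 < N by have [_ _ _] := Aq _ Am; exact: le_lt_trans (ler_norm _).
have := noncrossing (reach_trans (reach_trans Ge Gw) Gf) eb erefl _ cA _ _ Ak Am kb mb.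
rewrite /= !leNgt fk fm /= !addbF => h.
have ek : k.2 < e.2 by lra.
have em : ~~ (m.2 < e.2) by rewrite -leNgt; lra.
by move: em; rewrite -h ?ek //; [move=> p [] | move=> p /Aq[] |
  apply/seteqP; split=> // p [? []]].
Qed.

Lemma far_countable : suslinian X -> countable [set y | far y].
Proof.
move=> sX.
have /choice[c hc] y : exists k, far y -> endpoint y k.
  have [fy|nfy] := pselect (far y); last by exists y.
  by have [k] := endpoint_exists fy; exists k.
have cb y : far y -> c y = (b, (c y).2).
  by move=> /hc[cyb _ _]; rewrite [LHS]surjective_pairing cyb.
pose S := [set s | exists2 y, far y & (c y).2 = s].
have /choice[g hg] s : exists y, S s -> far y /\ (c y).2 = s.
  have [[y fy ys]|nS] := pselect (S s); first by exists y.
  by exists (0, 0).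
have /choice[j hj] s : exists J : set plane, S s -> [/\ continuum J,
    Defs.nondegenerate J, J `<=` K (g s) `&` [set p | a <= p.1] & J (b, s)].
  have [Ss|nS] := pselect (S s); last by exists set0.
  have [fs cs] := hg _ Ss; have [J] := endpoint_continuum fs (hc _ fs).
  by rewrite (cb _ fs) cs; exists J.
(* Heights with a free interval just above them, or with nothing of [S] above; distinct ones have
   distinct rationals [q]. *)
pose gap := [set s | S s /\ exists q : rat, s < ratr q /\
  forall u, S u -> s < u -> ratr q < u].
have cgap : countable gap.
  have /choice[r hr] s : exists q : rat, gap s -> s < ratr q /\
      forall u, S u -> s < u -> ratr q < u.
    have [[Ss [q hq]]|ns] := pselect (gap s); first by exists q.
    by exists 0.
  apply/countable_injP; exists (pickle \o r) => s t; rewrite !inE => gs gt.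
  move=> /(pcan_inj pickleK) rst; apply/eqP; rewrite eq_le.
  have [s1 s2] := hr _ gs; have [t1 t2] := hr _ gt.
  apply/andP; split; rewrite leNgt; apply/negP => st.
    by have := t2 _ gs.1 st; rewrite -rst ltNge (ltW s1).
  by have := s2 _ gt.1 st; rewrite rst ltNge (ltW t1).
have jlt s t : S s -> S t -> ~ gap s -> s < t -> j s `&` j t = set0.
  move=> Ss St ngs st.
  have [u [Su su ut]] : exists u, [/\ S u, s < u & u < t].
    have [q] := rat_in_itvoo st; rewrite in_itv /= => /andP[sq qt].
    apply: contrapT => nou; apply: ngs; split=> //; exists q; split=> // u Su su.
    by apply: (lt_le_trans qt); rewrite leNgt; apply/negP => ut; apply: nou; exists u.
  have [fs cs] := hg _ Ss; have [ft ct] := hg _ St; have [fu cu] := hg _ Su.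
  have [Jc _ JK Jk] := hj _ Ss; have [Lc _ LK Lm] := hj _ St.
  apply: (disjoint_between fs fu ft _ _ _ (hc _ fu) _ _ _ Jc Lc JK LK Jk Lm);
    rewrite ?cu //=.
  - by move=> E; move: su; rewrite -cu E cs ltxx.
  - by move=> E; move: ut; rewrite -cu E ct ltxx.
  - by move: (hc _ fs); rewrite (cb _ fs) cs.
  - by move: (hc _ ft); rewrite (cb _ ft) ct.
pose D := S `\` gap.
have jdis s t : D s -> D t -> s <> t -> j s `&` j t = set0.
  move=> [Ss ns] [St nt] /eqP; rewrite neq_lt => /orP[st|ts]; first exact: jlt.
  by rewrite setIC; exact: jlt.
have cF : countable (j @` D).
  apply: sX => [_ [s [Ss _] <-]|_ _ [s Ds <-] [t Dt <-] st].
    have [fs _] := hg _ Ss; have [Jc Jn JK _] := hj _ Ss; split=> // z /JK[/K_qcl[qz _] _].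
    exact: qcl_X fs _ qz.
  by apply: jdis => // E; apply: st; rewrite E.
have cD : countable D.
  (* [j] is injective on [D]: for distinct [s] and [t] in [D] the sets are disjoint, and [j s]
     contains [(b, s)]. *)
  have /countable_injP[h hi] := cF; apply/countable_injP; exists (h \o j) => s t.
  rewrite !inE => Ds Dt /hi; rewrite !inE => E; apply: contrapT => st.
  have [_ _ _ js] := hj _ Ds.1.
  rewrite -[False]/(set0 (b, s)) -(jdis _ _ Ds Dt st); split=> //.
  by rewrite -E.
have cS : countable S.
  apply: (@sub_countable _ _ _ (\bigcup_i (if i then D else gap))).
    apply: subset_card_le => s Ss.
    by have [gs|ngs] := pselect (gap s); [exists false | exists true].
  by apply: bigcup_countable => [|[]].
apply: (@sub_countable _ _ _ (\bigcup_(s in S) [set y | far y /\ (c y).2 = s])).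
  by apply: subset_card_le => y fy; exists (c y).2 => //; exists y.
apply: bigcup_countable => // s _.
(* Each fibre of the endpoint map has at most two points. *)
have no3 x y z : far x /\ (c x).2 = s -> far y /\ (c y).2 = s ->
    far z /\ (c z).2 = s -> x <> y -> x <> z -> y <> z -> False.
  move=> [fx xs] [fy ys] [fz zs] xy xz yz.
  apply: (no_common_endpoint (k := (b, s)) fx fy fz xy xz yz);
    [rewrite -xs -(cb _ fx) | rewrite -ys -(cb _ fy) | rewrite -zs -(cb _ fz)]; exact: hc.
have [[x [y [hx hy xy]]]|no2] := pselect (exists x y, [/\ far x /\ (c x).2 = s,
    far y /\ (c y).2 = s & x <> y]).
  apply: (@sub_countable _ _ _ [set x; y]); last first.
    exact/finite_set_countable/finite_set2.
  apply: subset_card_le => z hz /=; apply: contrapT => nz; apply: (no3 x y z) => //.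
    by move=> E; apply: nz; left.
  by move=> E; apply: nz; right.
apply/countable_injP; exists (fun=> 0%N) => x y; rewrite !inE => hx hy _.
by apply: contrapT => xy; apply: no2; exists x, y.
Qed.

End HalfPlane.

(** * Reduction to the half-plane case *)

Section Transport.
Variables (R : realType) (T : pseudoMetricType R) (f g : T -> T).
Hypotheses (cf : continuous f) (cg : continuous g).
Hypotheses (fK : cancel f g) (gK : cancel g f).
Implicit Types (X Y C : set T) (x y : T).

Lemma preimage_image_can X : g @^-1` X = f @` X.
Proof.
apply/seteqP; split=> [x Xx|_ [x Xx <-]]; last by rewrite /preimage /= fK.
by exists (g x).
Qed.

Lemma clopen_in_preimage Y C : clopen_in Y C -> clopen_in (g @^-1` Y) (g @^-1` C).
Proof.
move=> [CY [[U [oU CU]] [F [cF CF]]]]; split; first by move=> x /CY.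
split; [exists (g @^-1` U) | exists (g @^-1` F)].
  split; last by rewrite CU preimage_setI.
  by apply: open_comp oU => x _; exact: cg.
split; last by rewrite CF preimage_setI.
by apply: preimage_closed cF => x _; exact: cg.
Qed.

Lemma tot_disconnected_preimage Y :
  tot_disconnected Y -> tot_disconnected (g @^-1` Y).
Proof.
move=> tY x y Yx Yy xy.
have [|C [cC [Cx Cy]]] := tY _ _ Yx Yy; first by move=> /(can_inj gK).
by exists (g @^-1` C); split=> //; exact: clopen_in_preimage.
Qed.

Lemma compact_preimage_can X : compact X -> compact (g @^-1` X).
Proof.
rewrite preimage_image_can; apply: continuous_compact.
exact: continuous_subspaceT.
Qed.

End Transport.

Lemma qcl_preimage (R : realType) (T : pseudoMetricType R) (f g : T -> T)
    (Y : set T) (x y : T) :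
  continuous f -> continuous g -> cancel f g -> cancel g f ->
  qcl Y y x -> qcl (g @^-1` Y) (f y) (f x).
Proof.
move=> cf cg fK gK qx C [cC Cy] V Vfx.
have := clopen_in_preimage cf cC; rewrite -comp_preimage (_ : g \o f = id); last first.
  by apply/funext => z /=; rewrite fK.
move=> cD; have [z [Cz Vz]] := qx _ (conj cD Cy) _ (cf _ _ Vfx).
by exists (f z).
Qed.

Lemma suslinian_preimage (R : realType) (T : pseudoMetricType R) (f g : T -> T)
    (X : set T) :
  continuous f -> continuous g -> cancel f g -> cancel g f ->
  suslinian X -> suslinian (g @^-1` X).
Proof.
move=> cf cg fK gK sX F hF dF.
have fgK A : g @^-1` (f @^-1` A) = A.
  by apply/seteqP; split=> z; rewrite /preimage /= gK.
apply: (@sub_countable _ _ _ (preimage g @` (preimage f @` F))).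
  apply: subset_card_le => A FA; exists (f @^-1` A) => //; exists A => //.
apply: sub_countable (card_image_le _ _) _; apply: sX.
  move=> _ [A FA <-]; have [AX [[[z Az] [cA oA]] [u [v [Au [Av uv]]]]]] := hF _ FA.
  split; first by move=> w /AX; rewrite /preimage /= fK.
  split; last first.
    exists (g u), (g v); rewrite /preimage /= !gK; split=> //.
    by split=> // /(can_inj gK).
  split; first by exists (g z); rewrite /preimage /= gK.
  split; first exact: (compact_preimage_can cg gK fK cA).
  rewrite (preimage_image_can gK fK); apply: connected_continuous_connected => //.
  exact: continuous_subspaceT.
move=> _ _ [A FA <-] [B FB <-] AB; rewrite -preimage_setI dF ?preimage_set0 //.
by move=> E; apply: AB; rewrite E.
Qed.

(** Followed by [reflect_if], this makes any of [p.1], [- p.1], [p.2], [- p.2] the first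
    coordinate. *)
Definition swap_if (R : realType) (i : bool) (p : R * R) : R * R :=
  if i then (p.2, p.1) else p.

Definition reflect_if (R : realType) (i : bool) (p : R * R) : R * R :=
  if i then (- p.1, p.2) else p.

Lemma swap_if_continuous (R : realType) i : continuous (@swap_if R i).
Proof.
case: i => p; last exact: cvg_id.
by apply: continuous_pair => q; [exact: cvg_snd | exact: cvg_fst].
Qed.

Lemma reflect_if_continuous (R : realType) i : continuous (@reflect_if R i).
Proof.
case: i => p; last exact: cvg_id.
apply: continuous_pair => q; last exact: cvg_snd.
by apply: cvgN; exact: cvg_fst.
Qed.

Lemma swap_ifK (R : realType) i : involutive (@swap_if R i).
Proof. by case: i => // -[]. Qed.

Lemma reflect_ifK (R : realType) i : involutive (@reflect_if R i).
Proof. by case: i => // -[? ?]; rewrite /reflect_if /= opprK. Qed.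

(** [far_countable] for the images of [X] and [Y] under [f], written as preimages under [g]. *)
Lemma far_countable_iso (R : realType) (X Y : set (R * R)%type) (a b : R)
    (f g : (R * R)%type -> (R * R)%type) :
  continuous f -> continuous g -> cancel f g -> cancel g f ->
  compact X -> suslinian X -> Y `<=` X -> tot_disconnected Y -> a < b ->
  countable [set y | [/\ Y y, (f y).1 < a & exists2 q, qcl Y y q & b < (f q).1]].
Proof.
move=> cf cg fK gK cX sX YX tY ab.
have cX' := compact_preimage_can cf fK gK cX.
have tY' := tot_disconnected_preimage cg gK tY.
have YX' : g @^-1` Y `<=` g @^-1` X by move=> z /YX.
have sX' := suslinian_preimage cf cg fK gK sX.
have cfar := far_countable cX' YX' tY' ab sX'.
apply: (@sub_countable _ _ _ (g @` [set y | far (g @^-1` Y) a b y])).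
  apply: subset_card_le => y [Yy ya [q yq bq]]; exists (f y) => //.
  split=> //; first by rewrite /preimage /= fK.
  by exists (f q) => //; exact: qcl_preimage.
exact: sub_countable (card_image_le _ _) cfar.
Qed.

Lemma two_rats_between (R : realType) (s t : R) : s < t ->
  exists q r : rat, [/\ s < ratr q, q < r & ratr r < t].
Proof.
move=> /rat_in_itvoo[q]; rewrite in_itv /= => /andP[sq qt].
have [r] := rat_in_itvoo qt; rewrite in_itv /= ltr_rat => /andP[qr rt].
by exists q, r.
Qed.

Theorem theoremA (R : realType) (X Y : set (R * R)%type) :
  continuum X -> suslinian X ->
  Y `<=` X -> borel_set Y -> tot_disconnected Y ->
  countable (Lambda Y).
Proof.
move=> [_ [cX _]] sX YX _ tY.
pose f (i j : bool) (p : R * R) := reflect_if j (swap_if i p).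
(* The Booleans choose the isometry, the rationals the strip. *)
pose I := [set u : bool * bool * rat * rat | u.1.2 < u.2].
pose F (u : bool * bool * rat * rat) := [set y | [/\ Y y,
  (f u.1.1.1 u.1.1.2 y).1 < ratr u.1.2 &
  exists2 q, qcl Y y q & ratr u.2 < (f u.1.1.1 u.1.1.2 q).1]].
apply: (@sub_countable _ _ _ (\bigcup_(u in I) F u)); last first.
  apply: bigcup_countable => // -[[[i j] q] r] qr.
  apply: (@far_countable_iso _ X _ _ _ _ (swap_if i \o reflect_if j)) => //=.
  - move=> p; apply: continuous_comp; first exact: swap_if_continuous.
    exact: reflect_if_continuous.
  - move=> p; apply: continuous_comp; first exact: reflect_if_continuous.
    exact: swap_if_continuous.
  - by move=> p; rewrite /f /= reflect_ifK swap_ifK.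
  - by move=> p; rewrite /f /= swap_ifK reflect_ifK.
  - by rewrite ltr_rat.
apply: subset_card_le => y Ly.
have [z yz zy] := Lambda_qcl cX (compact_plane_closed cX) YX Ly.
(* [z] differs from [y] in some coordinate, so one of the four isometries puts it to the right of
   [y]. *)
suff [i [j fyz]] : exists i j, (f i j y).1 < (f i j z).1.
  have [q [r [yq qr rz]]] := two_rats_between fyz.
  by exists (i, j, q, r) => //; split=> //; [exact: Ly.1 | exists z].
have [zy1|] := eqVneq z.1 y.1; last first.
  rewrite neq_lt => /orP[zy1|yz1]; last by exists false, false.
  by exists false, true; rewrite /f /= ltrN2.
have : z.2 != y.2.
  apply/eqP => zy2; apply: zy.
  by rewrite [z]surjective_pairing [y]surjective_pairing zy1 zy2.
rewrite neq_lt => /orP[zy2|yz2]; last by exists true, false.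
by exists true, true; rewrite /f /= ltrN2.
Qed.
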